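(* Let $K$ be a field, $S=K[x_1,\ldots,x_n]$, and let $I\subset S$ be a nonzero proper monomial ideal. If $\operatorname{bigsize}(I)=1$, then $I$ has minimal depth, i.e. $\operatorname{depth}(I)=\operatorname{size}(I)+1$.
   Context: Depth is taken with respect to the graded maximal ideal $\mathfrak m=(x_1,\ldots,x_n)$ of $S$, with ideals regarded as $S$-modules. Size and bigsize: let $I=\bigcap_{i=1}^s Q_i$ be an irredundant primary decomposition of the nonzero proper monomial ideal $I$, where the $Q_i$ are monomial ideals and $Q_i$ is $P_i$-primary, with the $P_i$ pairwise distinct, so $\operatorname{Ass}(S/I)=\{P_1,\ldots,P_s\}$. Let $b=\operatorname{height}(\sum_{j=1}^s Q_j)$. Then $\operatorname{size}(I)=a+(n-b)-1$, where $a$ is the minimum number $t$ such that there exist $j_1<\cdots<j_t$ with $\sqrt{\sum_{l=1}^t Q_{j_l}}=\sqrt{\sum_{j=1}^s Q_j}$. The number $\operatorname{bigsize}(I)$ is $a'+(n-b)-1$, where $a'$ is the minimum number $t$ (with $1\le t\le s$) such that for all $j_1<\cdots<j_t$ one has $\sqrt{\sum_{l=1}^t Q_{j_l}}=\sqrt{\sum_{j=1}^s Q_j}$. Both depend only on $\operatorname{Ass}(S/I)$. The ideal $I$ is said to have minimal depth if $\operatorname{depth}(I)=\operatorname{size}(I)+1$. *)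

(* Defs.v *)
From mathcomp Require Import all_boot all_order all_algebra ring_quotient.
From mathcomp Require Import boolp classical_sets.
From mathcomp Require Import mpoly.

Set Implicit Arguments.
Unset Strict Implicit.
Unset Printing Implicit Defensive.

Import GRing.Theory.
Local Open Scope classical_set_scope.
Local Open Scope ring_scope.

Definition is_min (A : set nat) (k : nat) : Prop :=
  A k /\ forall l, A l -> (k <= l)%N.

Definition is_max (A : set nat) (k : nat) : Prop :=
  A k /\ forall l, A l -> (l <= k)%N.

(* Unlike [idealr_closed], this allows the unit ideal. *)
Definition ideal (R : comNzRingType) (I : set R) : Prop :=
  I 0 /\ forall a u v, I u -> I v -> I (a * u + v).

Definition ideal_gen (R : comNzRingType) (G : set R) : set R :=
  smallest (@ideal R) G.

Definition radical (R : comNzRingType) (I : set R) : set R :=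
  [set f | exists k : nat, I (f ^+ k)].

(* [idealr_closed] includes properness. *)
Definition prime_ideal (R : comNzRingType) (P : set R) : Prop :=
  idealr_closed (mem P) /\ prime_idealr_closed (mem P).

Definition primary_ideal (R : comNzRingType) (Q : set R) : Prop :=
  [/\ ideal Q, ~ Q 1
    & forall f g, Q (f * g) -> Q f \/ radical Q g].

Definition ideal_sum (R : comNzRingType) (s : nat) (Q : 'I_s -> set R)
    (A : {set 'I_s}) : set R :=
  [set f | exists2 g : 'I_s -> R,
     forall j, j \in A -> Q j (g j) & f = \sum_(j in A) g j].

Definition prime_height (R : comNzRingType) (P : set R) (h : nat) : Prop :=
  is_max [set l : nat | exists C : nat -> set R,
            [/\ forall i, (i <= l)%N -> prime_ideal (C i),
                forall i, (i < l)%N -> C i `<` C i.+1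
              & C l = P]] h.

Definition height (R : comNzRingType) (J : set R) (h : nat) : Prop :=
  is_min [set l : nat | exists P : set R,
            [/\ prime_ideal P, J `<=` P & prime_height P l]] h.

(* [seq_mul fs M] is (f_0, ..., f_{r-1}) M, for M an ideal. *)
Definition seq_mul (R : comNzRingType) (fs : seq R) (M : set R) : set R :=
  [set u | exists2 g : nat -> R,
     forall k, M (g k) & u = \sum_(k < size fs) fs`_k * g k].

(* [fs] is a regular sequence on the ideal M viewed as an R-module: f_k is a
   nonzerodivisor on M / (f_0, ..., f_{k-1}) M and M / (fs) M is nonzero. *)
Definition regular_seq (R : comNzRingType) (M : set R) (fs : seq R) : Prop :=
  (forall k, (k < size fs)%N -> forall u, M u ->
     seq_mul (take k fs) M (fs`_k * u) -> seq_mul (take k fs) M u)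
  /\ seq_mul fs M <> M.

Definition graded_maximal (K : fieldType) (n : nat) : set {mpoly K[n]} :=
  ideal_gen [set f | exists i : 'I_n, f = 'X_i].
Arguments graded_maximal : clear implicits.

Definition depth (K : fieldType) (n : nat) (M : set {mpoly K[n]}) (d : nat)
    : Prop :=
  is_max [set l : nat | exists fs : seq {mpoly K[n]},
            [/\ size fs = l,
                forall f, f \in fs -> graded_maximal K n f
              & regular_seq M fs]] d.

Definition monomial_ideal (K : fieldType) (n : nat) (I : set {mpoly K[n]})
    : Prop :=
  exists G : set 'X_{1..n},
    I = ideal_gen [set f | exists2 m, G m & f = 'X_[m]].

(* The associated primes are the [radical (Q j)]; irredundance means that they
   are pairwise distinct and that no [Q j] can be omitted. *)
Definition monomial_primary_decomposition (K : fieldType) (n s : nat)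
    (I : set {mpoly K[n]}) (Q : 'I_s -> set {mpoly K[n]}) : Prop :=
  [/\ forall j, monomial_ideal (Q j) /\ primary_ideal (Q j),
      injective (fun j => radical (Q j)),
      I = \bigcap_j Q j
    & forall j, \bigcap_(k in [set k | k <> j]) Q k <> I].

Definition sum_radical_full (R : comNzRingType) (s : nat) (Q : 'I_s -> set R)
    (A : {set 'I_s}) : Prop :=
  radical (ideal_sum Q A) = radical (ideal_sum Q [set: 'I_s]%SET).

(* Indices j_1 < ... < j_t are encoded as subsets A of 'I_s with t elements.
   [size_of] and [bigsize_of] compute size(I) and bigsize(I) from an
   irredundant monomial primary decomposition Q of I. *)
Definition size_of (K : fieldType) (n s : nat)
    (Q : 'I_s -> set {mpoly K[n]}) (z : int) : Prop :=
  exists a b : nat,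
    [/\ is_min [set t : nat | exists2 A : {set 'I_s},
                  #|A| = t & sum_radical_full Q A] a,
        height (ideal_sum Q [set: 'I_s]%SET) b
      & z = a%:Z + (n%:Z - b%:Z) - 1].

Definition bigsize_of (K : fieldType) (n s : nat)
    (Q : 'I_s -> set {mpoly K[n]}) (z : int) : Prop :=
  exists a b : nat,
    [/\ is_min [set t : nat | (1 <= t <= s)%N /\
                  forall A : {set 'I_s}, #|A| = t -> sum_radical_full Q A] a,
        height (ideal_sum Q [set: 'I_s]%SET) b
      & z = a%:Z + (n%:Z - b%:Z) - 1].

Definition minimal_depth (K : fieldType) (n s : nat)
    (I : set {mpoly K[n]}) (Q : 'I_s -> set {mpoly K[n]}) : Prop :=
  exists (d : nat) (z : int), [/\ depth I d, size_of Q z & d%:Z = z + 1].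

(* Main.v *)
Require Import Defs.
From mathcomp Require Import all_boot all_order all_algebra.
From mathcomp Require Import boolp classical_sets.
From mathcomp Require Import mpoly.
From mathcomp Require Import ring zify.

(** Write [J] for the sum of the components [Q j] and [A] for the set of variables
    in its radical. The radical of [J] is the prime generated by [A], so its
    height [b] is [#|A|], and bigsize one means [a' + (n - b) = 2], where [a']
    is the least number such that any [a'] components have a sum with the
    radical of [J]. As [b <= n], either [a'] is one or [b] is [n].
    There are three cases.

    If some component is primary to the maximal ideal [m], then the size is [0]
    and [S / I] has a nonzero class killed by [m]; for a domain [S] this
    forbids a regular sequence of length two on [I] ([depth_embedded]).

    If [b = n] and no component is primary to [m], then any two radicals span
    [m], the size is [1], and removing the closed point disconnects the
    spectrum of [S / I]; hence the first local cohomology of [S / I] is not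
    zero ([depth_disconnected]). If [b = n - 1], there is a single component,
    the size is again [1], and [S / I] has dimension one, so that the same
    local cohomology does not vanish ([depth_line]).

    In the last two cases the depth is two. The lower bound holds because the sum
    of the variables lies in none of the associated primes, so it is regular on
    [S / I] as well as on [S], and some variable continues it
    ([ex_regular2]). For the upper bound, the cohomology class is turned into a
    homomorphism [phi] from [m] to [S / I] that is not a multiplication, and
    such a [phi] is incompatible with a regular sequence of length three on
    [I] ([regular_size_le2]). The argument divides one polynomial by another,
    which is possible because a monomial ideal stable under multiplication by a
    fraction forces the fraction to be a polynomial
    ([monomial_ideal_conductor]).

    The value of the height rests on the bound [n] for the length of chains of
    primes ([prime_chain_length]): a strict chain yields algebraically
    independent elements, and counting monomials shows that more than [n]
    polynomials in [n] variables are dependent. *)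

Set Implicit Arguments.
Unset Strict Implicit.
Unset Printing Implicit Defensive.

Import GRing.Theory Order.TTheory.
Local Open Scope classical_set_scope.
Local Open Scope ring_scope.

(** * Ideals *)

Section Ideals.
Variable R : comNzRingType.
Implicit Types (I J P Q : set R) (u v : R).

Lemma ideal0 I : ideal I -> I 0.
Proof. by case. Qed.

Lemma idealM I a u : ideal I -> I u -> I (a * u).
Proof. by case=> I0 Icl Iu; have := Icl a u 0 Iu I0; rewrite addr0. Qed.

Lemma ideal_mulr I a u : ideal I -> I u -> I (u * a).
Proof. by rewrite mulrC; exact: idealM. Qed.

Lemma idealD I u v : ideal I -> I u -> I v -> I (u + v).
Proof. by case=> I0 Icl Iu Iv; have := Icl 1 u v Iu Iv; rewrite mul1r. Qed.

Lemma idealN I u : ideal I -> I u -> I (- u).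
Proof. by move=> idI Iu; rewrite -mulN1r; exact: idealM. Qed.

Lemma idealB I u v : ideal I -> I u -> I v -> I (u - v).
Proof. by move=> idI Iu Iv; apply: idealD => //; exact: idealN. Qed.

Lemma ideal_big I (T : Type) (r : seq T) (P : pred T) (F : T -> R) :
  ideal I -> (forall i, P i -> I (F i)) -> I (\sum_(i <- r | P i) F i).
Proof.
move=> idI IF; apply: (big_ind I) => //; first exact: ideal0.
by move=> u v; exact: idealD.
Qed.

Lemma ideal_bigcap (T : Type) (D : set T) (F : T -> set R) :
  (forall i, ideal (F i)) -> ideal (\bigcap_(i in D) F i).
Proof.
move=> idF; split; first by move=> i _; exact: ideal0.
by move=> a u v Fu Fv i Di; apply: idealD (Fv i Di) => //; exact: idealM (Fu i Di).
Qed.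

Definition ideal_add I J : set R :=
  [set f | exists p q, [/\ I p, J q & f = p + q]].

Lemma ideal_addP I J : ideal I -> ideal J -> ideal (ideal_add I J).
Proof.
move=> idI idJ; split; first by exists 0, 0; rewrite addr0; split=> //; exact: ideal0.
move=> a _ _ [p] [q] [Ip Jq ->] [p'] [q'] [Ip' Jq' ->].
exists (a * p + p'), (a * q + q'); split.
- by apply: idealD => //; exact: idealM.
- by apply: idealD => //; exact: idealM.
- by rewrite mulrDr addrACA.
Qed.

Lemma ideal_addl I J u : ideal J -> I u -> ideal_add I J u.
Proof. by move=> idJ Iu; exists u, 0; rewrite addr0; split=> //; exact: ideal0. Qed.

Lemma ideal_addr I J u : ideal I -> J u -> ideal_add I J u.
Proof. by move=> idI Ju; exists 0, u; rewrite add0r; split=> //; exact: ideal0. Qed.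

Lemma colon_ideal I w : ideal I -> ideal [set f | I (f * w)].
Proof.
move=> idI; split=> /=; first by rewrite mul0r; exact: ideal0.
move=> a u v Iu Iv; rewrite mulrDl -mulrA.
by apply: idealD => //; exact: idealM.
Qed.

Lemma principal_ideal w : ideal [set f : R | exists t, f = w * t].
Proof.
split=> /=; first by exists 0; rewrite mulr0.
by move=> a _ _ [t ->] [t' ->]; exists (a * t + t'); rewrite mulrDr mulrCA.
Qed.

Lemma ideal_gen_ideal (G : set R) : ideal (ideal_gen G).
Proof.
split; first by move=> A [idA _]; exact: ideal0.
move=> a u v Gu Gv A AG.
by apply: idealD; [case: AG | apply: idealM (Gu A AG); case: AG | exact: Gv].
Qed.

Lemma ideal_gen_sub (G : set R) J : ideal J -> G `<=` J -> ideal_gen G `<=` J.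
Proof. by move=> idJ GJ u; apply; split. Qed.

Lemma sub_ideal_gen (G : set R) : G `<=` ideal_gen G.
Proof. by move=> u Gu A [_ GA]; exact: GA. Qed.

Lemma sub_radical I : I `<=` radical I.
Proof. by move=> u Iu; exists 1%N; rewrite expr1. Qed.

Lemma radical_ideal I : ideal I -> ideal (radical I).
Proof.
move=> idI; split; first by exists 1%N; rewrite expr1; exact: ideal0.
move=> a u v [k Iu] [l Iv]; exists (k + l)%N; rewrite exprDn.
apply: ideal_big => // i _; rewrite -mulr_natl; apply: idealM => //.
(* the exponents of [u] and [v] add up to [k + l], so one of them is large *)
case: (leqP l i) => [li|il].
- by apply: idealM => //; rewrite -(subnK li) exprD; exact: idealM.
- apply: ideal_mulr => //; rewrite exprMn; apply: idealM => //.
  have -> : (k + l - i = (l - i) + k)%N by lia.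
  by rewrite exprD; exact: idealM.
Qed.

Lemma radical_sub I J : I `<=` J -> radical I `<=` radical J.
Proof. by move=> IJ u [k Iu]; exists k; exact: IJ. Qed.

Lemma prime_idealP P :
  prime_ideal P <->
  [/\ ideal P, ~ P 1 & forall u v, P (u * v) -> P u \/ P v].
Proof.
split=> [[[P0 P1 Pcl] Ppr] | [[P0 Pcl] P1 Ppr]].
- split.
  + split=> [|a u v Pu Pv]; first by move: P0; rewrite inE.
    by have := Pcl a u v; rewrite !inE; exact.
  + by move: P1; rewrite notin_setE.
  + by move=> u v Puv; have := Ppr u v; rewrite !inE => /(_ Puv) /orP[];
      rewrite inE; [left | right].
- split; first split; rewrite ?inE ?notin_setE //.
  + by move=> a u v; rewrite !inE; exact: Pcl.
  + by move=> u v; rewrite inE => /Ppr[Pu|Pv]; apply/orP; rewrite !inE;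
      [left | right].
Qed.

Lemma prime_ideal_exp P u k : prime_ideal P -> P (u ^+ k) -> P u.
Proof.
move=> /prime_idealP[_ P1 Ppr]; elim: k => [|k IHk]; first by rewrite expr0.
by rewrite exprS => /Ppr[].
Qed.

Lemma radical_sub_prime I P : prime_ideal P -> I `<=` P -> radical I `<=` P.
Proof. by move=> prP IP u [k Iu]; apply: prime_ideal_exp (IP _ Iu). Qed.

Lemma primary_radical_prime Q : primary_ideal Q -> prime_ideal (radical Q).
Proof.
move=> [idQ Q1 Qpr]; apply/prime_idealP; split; first exact: radical_ideal.
  by case=> k; rewrite expr1n.
move=> u v [k]; rewrite exprMn => /Qpr[Qu|[l Qv]]; first by left; exists k.
by right; exists (k * l)%N; rewrite exprM.
Qed.

Lemma ideal_sum_ideal s (Q : 'I_s -> set R) (A : {set 'I_s}) :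
  (forall j, ideal (Q j)) -> ideal (ideal_sum Q A).
Proof.
move=> idQ; split.
  by exists (fun=> 0) => [j _|]; [exact: ideal0 | rewrite big1].
move=> a _ _ [g Qg ->] [h Qh ->]; exists (fun j => a * g j + h j).
  by move=> j jA; apply: idealD; [| apply: idealM (Qg j jA) | exact: Qh].
by rewrite big_split mulr_sumr.
Qed.

Lemma sub_ideal_sum s (Q : 'I_s -> set R) (A : {set 'I_s}) j :
  (forall j, ideal (Q j)) -> j \in A -> Q j `<=` ideal_sum Q A.
Proof.
move=> idQ jA u Qu; exists (fun k => if k == j then u else 0).
  by move=> k _; case: eqP => [-> //|_]; exact: ideal0.
by rewrite (bigD1 j) //= eqxx big1 ?addr0 // => k /andP[_ /negPf->].
Qed.

Lemma ideal_sum_sub s (Q : 'I_s -> set R) (A : {set 'I_s}) J :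
  ideal J -> (forall j, j \in A -> Q j `<=` J) -> ideal_sum Q A `<=` J.
Proof.
by move=> idJ QJ _ [g Qg ->]; apply: ideal_big => // j jA; exact: QJ (Qg j jA).
Qed.

End Ideals.

Lemma ex_is_min (A : set nat) : (exists k, A k) -> exists k, is_min A k.
Proof.
case=> k Ak; have [|k' /asboolP Ak' k'min] := @ex_minnP (fun k => `[< A k >]).
  by exists k; apply/asboolP.
by exists k'; split=> // l Al; apply: k'min; apply/asboolP.
Qed.

(** * Monomial ideals *)

Section Monomials.
Variables (K : fieldType) (n : nat).
Local Notation S := {mpoly K[n]}.
Implicit Types (I J P Q : set S) (f g u v w : S) (m : 'X_{1..n}) (A : {set 'I_n}).

Lemma ideal_mpolyZ I (c : K) u : ideal I -> I u -> I (c *: u).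
Proof. by move=> idI Iu; rewrite -mul_mpolyC; exact: idealM. Qed.

Lemma ideal_mpolyX_le I m m' :
  ideal I -> (m <= m')%MM -> I 'X_[m] -> I 'X_[m'].
Proof. by move=> idI le_mm' Im; rewrite -(submK le_mm') mpolyXD; exact: idealM. Qed.

Lemma ideal_msupp I f :
  ideal I -> (forall m, m \in msupp f -> I 'X_[m]) -> I f.
Proof.
move=> idI If; rewrite (mpolyE f) big_seq.
by apply: ideal_big => // m /If; exact: ideal_mpolyZ.
Qed.

(** Containment in such an ideal is how an ideal given by generators is bounded
    from above through the exponents of its members. *)
Lemma msupp_ideal (D : 'X_{1..n} -> Prop) :
  (forall m m', D m -> D (m' + m)%MM) ->
  ideal [set f : S | forall m, m \in msupp f -> D m].
Proof.
move=> Dcl; split=> /=; first by move=> m; rewrite -mpolyC0 msupp0.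
move=> a u v Du Dv m /msuppD_le; rewrite mem_cat => /orP[|/Dv //].
by move=> /msuppM_le /allpairsP[[m1 m2] /= [_ /Du Dm2 ->]]; exact: Dcl.
Qed.

Lemma monomial_ideal_ideal I : monomial_ideal I -> ideal I.
Proof. by case=> G ->; exact: ideal_gen_ideal. Qed.

Lemma monomial_ideal_msupp I f m :
  monomial_ideal I -> I f -> m \in msupp f -> I 'X_[m].
Proof.
move=> monI; have idI := monomial_ideal_ideal monI; case: (monI) => G defI If.
pose D (m : 'X_{1..n}) := I 'X_[m].
suff: I `<=` [set f : S | forall m, m \in msupp f -> D m] by move=> /(_ f If m).
rewrite {1}defI; apply: ideal_gen_sub.
  by apply: msupp_ideal => k k' Ik; apply: ideal_mpolyX_le Ik; rewrite ?lem_addl.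
move=> _ [k Gk ->] m'; rewrite msuppX inE => /eqP->.
by rewrite /D defI; apply: sub_ideal_gen; exists k.
Qed.

Lemma monomial_ideal_exX I :
  monomial_ideal I -> I <> [set 0] -> exists m, I 'X_[m].
Proof.
move=> monI I0; apply: contrapT => noX; apply: I0.
apply/seteqP; split=> [f If|_ ->] /=; last exact: ideal0 (monomial_ideal_ideal monI).
apply/eqP; rewrite -msupp_eq0; apply/eqP; case def_s: (msupp f) => [//|m s].
case: noX; exists m; apply: monomial_ideal_msupp monI If _.
by rewrite def_s mem_head.
Qed.

(** ** The primes generated by sets of variables *)

Definition var_subst A := [tuple if i \in A then 0 else 'X_i : S | i < n].

(** The ideal generated by the variables in [A], as the kernel of the
    substitution that kills them: in this form primality is immediate. *)
Definition var_ideal A : set S := [set f | f \mPo var_subst A = 0].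

Lemma var_ideal_prime A : prime_ideal (var_ideal A).
Proof.
apply/prime_idealP; split; first split; rewrite /var_ideal /=.
- exact: comp_mpoly0.
- by move=> a u v u0 v0; rewrite comp_mpolyD rmorphM /= u0 v0 mulr0 addr0.
- by rewrite comp_mpoly1; apply/eqP; exact: oner_neq0.
- by move=> u v; rewrite rmorphM => /eqP; rewrite mulf_eq0 => /orP[] /eqP; tauto.
Qed.

Lemma var_ideal_ideal A : ideal (var_ideal A).
Proof. by have /prime_idealP[] := var_ideal_prime A. Qed.

Lemma var_ideal1 A : ~ var_ideal A 1.
Proof. by have /prime_idealP[] := var_ideal_prime A. Qed.

Lemma var_idealX A i : var_ideal A 'X_i <-> i \in A.
Proof.
rewrite /var_ideal /= comp_mpolyXU -tnth_nth tnth_mktuple; case: ifP => // _.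
by split=> // /eqP; rewrite -msupp_eq0 msuppX.
Qed.

Lemma var_ideal_sub A J :
  ideal J -> (forall i, i \in A -> J 'X_i) -> var_ideal A `<=` J.
Proof.
move=> idJ JA f; rewrite /var_ideal /= => f0.
suff: J (f - (f \mPo var_subst A)) by rewrite f0 subr0.
elim/mpolyind: f {f0} => [|c m f _ _ IHf]; first by rewrite comp_mpoly0 subr0; exact: ideal0.
rewrite comp_mpolyD comp_mpolyZ opprD addrACA -scalerBr.
apply: idealD => //; apply: ideal_mpolyZ => //.
rewrite comp_mpolyX mpolyXE_id.
have tnE i : tnth (var_subst A) i = if i \in A then 0 else 'X_i.
  by rewrite tnth_mktuple.
under [X in _ - X]eq_bigr => i _ do rewrite tnE.
apply: (big_ind2 (fun u v : S => J (u - v))).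
- by rewrite subrr; exact: ideal0.
- move=> u u' v v' Ju Jv.
  have -> : u * v - u' * v' = v * (u - u') + u' * (v - v') by ring.
  by apply: idealD => //; exact: idealM.
- move=> i _; case: ifP => [iA|_]; last by rewrite subrr; exact: ideal0.
  case: (m i) => [|k]; first by rewrite !expr0 subrr; exact: ideal0.
  by rewrite [in X in _ - X]exprS mul0r subr0 exprS; apply: ideal_mulr => //; exact: JA.
Qed.

Lemma var_ideal_proper A A' : (A \proper A')%SET -> var_ideal A `<` var_ideal A'.
Proof.
move=> /properP[/fintype.subsetP AA' [i iA' iA]]; split.
  apply: var_ideal_sub; first exact: var_ideal_ideal.
  by move=> j /AA' jA'; apply/var_idealX.
by move=> /(_ 'X_i) sub; move: iA => /negP; apply; apply/var_idealX/sub/var_idealX.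
Qed.

Lemma mpolyX_var_ideal A m i :
  i \in A -> (0 < m i)%N -> var_ideal A 'X_[m].
Proof.
move=> iA mi; have le_im: (U_(i) <= m)%MM by rewrite lep1mP -lt0n.
by apply: ideal_mpolyX_le le_im _; [exact: var_ideal_ideal | apply/var_idealX].
Qed.

Lemma prime_ideal_mpolyX P m :
  prime_ideal P -> P 'X_[m] -> exists2 i, (0 < m i)%N & P 'X_i.
Proof.
move=> prP; have /prime_idealP[_ P1 Ppr] := prP; rewrite mpolyXE_id.
apply: contraPP => noi; apply: (big_ind (fun u => ~ P u)) => //.
  by move=> u v Pu Pv /Ppr[].
move=> i _ Pi; apply: noi; exists i; last exact: prime_ideal_exp Pi.
by rewrite lt0n; apply/eqP => mi; move: Pi; rewrite mi expr0.
Qed.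

(** Every monomial of [Q] has a variable in the radical of [Q], because the
    radical is prime. *)
Lemma primary_monomial_sub_var Q A :
  monomial_ideal Q -> primary_ideal Q ->
  (forall i, radical Q 'X_i -> i \in A) -> Q `<=` var_ideal A.
Proof.
move=> monQ prQ QA f Qf; apply: ideal_msupp; first exact: var_ideal_ideal.
move=> m /(monomial_ideal_msupp monQ Qf) Qm.
have [|i mi /QA iA] := prime_ideal_mpolyX (primary_radical_prime prQ) (m := m).
  exact: sub_radical.
exact: mpolyX_var_ideal iA mi.
Qed.

(** ** The graded maximal ideal *)

Local Notation mm := (graded_maximal K n).

Lemma graded_maximal_ideal : ideal mm.
Proof. exact: ideal_gen_ideal. Qed.

Lemma graded_maximalX i : mm 'X_i.
Proof. by apply: sub_ideal_gen; exists i. Qed.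

Lemma graded_maximal_sub J : ideal J -> (forall i, J 'X_i) -> mm `<=` J.
Proof. by move=> idJ JX; apply: ideal_gen_sub => // _ [i ->]. Qed.

(** Every term of an element of the maximal ideal has positive degree, so
    multiplying by it raises the least degree occurring in a polynomial. *)
Lemma graded_maximal_mdeg e u d :
  mm e -> (forall m, m \in msupp u -> d <= mdeg m)%N ->
  forall m, m \in msupp (e * u) -> (d < mdeg m)%N.
Proof.
move=> me du; pose L := [set f : S | forall m, m \in msupp f -> (d < mdeg m)%N].
have idL : ideal L.
  by apply: (@msupp_ideal (fun m => d < mdeg m)%N) => m m' dm; rewrite mdegD; lia.
suff: mm `<=` [set f | L (f * u)] by move=> /(_ e me).
apply: graded_maximal_sub; first exact: colon_ideal.
move=> i m /msuppM_le /allpairsP[[m1 m2] /= [+ /du dm2 ->]].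
by rewrite msuppX inE mdegD => /eqP->; rewrite mdeg1.
Qed.

(** ** Socles *)

(** A monomial outside [D] can be enlarged one variable at a time while it stays
    outside [D]; this stops because monomials of large degree belong to [D]. *)
Lemma ex_socle_monomial (D : 'X_{1..n} -> Prop) :
  (forall m m', D m -> D (m' + m)%MM) ->
  (forall i, exists k, D (U_(i) *+ k)%MM) -> ~ D 0%MM ->
  exists2 m, ~ D m & forall i, D (U_(i) + m)%MM.
Proof.
move=> Dcl /choice[k Dk] D0; apply: contrapT => noD.
have grow m : ~ D m -> exists i, ~ D (U_(i) + m)%MM.
  move=> Dm; apply: contrapT => noi; apply: noD; exists m => // i.
  by apply: contrapT => Di; apply: noi; exists i.
have big d : exists2 m, ~ D m & mdeg m = d.
  elim: d => [|d [m /grow[i Di] <-]]; first by exists 0%MM; rewrite ?mdeg0.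
  by exists (U_(i) + m)%MM; rewrite // mdegD mdeg1.
have [m Dm degm] := big (\sum_i k i).+1.
have [i ki] : exists i, (k i <= m i)%N.
  apply: contrapT => noi; suff: (mdeg m <= \sum_i k i)%N by rewrite degm ltnn.
  rewrite mdegE; apply: leq_sum => i _; rewrite leqNgt; apply/negP => lt_km.
  by apply: noi; exists i; exact: ltnW.
apply: Dm; have le_km : (U_(i) *+ k i <= m)%MM.
  apply/mnm_lepP => j; rewrite mulmnE mnm1E; case: eqP => [<-|_]; last by rewrite mul0n.
  by rewrite mul1n.
by rewrite -(submK le_km); exact: Dcl.
Qed.

(** ** Divisibility by leading monomials *)

(** Division by [f]: if the leading monomial of [f] divides that of every
    nonzero member of [V], the division algorithm run inside [V] ends with
    remainder [0]. *)
Lemma mlead_descent (V : set S) f :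
  f != 0 ->
  (forall x t, V x -> V (x - f * t)) ->
  (forall x, V x -> x != 0 -> (mlead f <= mlead x)%MM) ->
  forall x, V x -> exists t, x = f * t.
Proof.
move=> f0 Vcl Vlead x; elim/mleadrect: x => x IHx Vx.
have [->|x0] := eqVneq x 0; first by exists 0; rewrite mulr0.
pose t : S := (mleadc x / mleadc f) *: 'X_[mlead x - mlead f].
have fc0 : mleadc f != 0 by rewrite mleadc_eq0.
have xc0 : mleadc x != 0 by rewrite mleadc_eq0.
have tc0 : mleadc x / mleadc f != 0 by rewrite mulf_neq0 // invr_eq0.
have t0 : t != 0 by rewrite scaler_eq0 (negPf tc0) -msupp_eq0 msuppX.
have lead_ft : (mlead f + mlead t)%MM = mlead x.
  by rewrite mleadZ // mleadXm addmC submK // Vlead.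
have leadt : mlead (f * t) = mlead x by rewrite mleadM.
have coeft : mleadc (f * t) = mleadc x.
  rewrite leadt -lead_ft mleadcM lead_ft /t mleadcZE mleadXm mcoeffX eqxx mulr1.
  by rewrite mulrC divfK.
have [y0|y0] := eqVneq (x - f * t) 0; first by exists t; apply/eqP; rewrite -subr_eq0 y0.
have lt_lead : (mlead (x - f * t) < mlead x)%O.
  rewrite lt_neqAle; apply/andP; split; last first.
    by apply: le_trans (mleadB_le _ _) _; rewrite leadt joinxx.
  apply/eqP => eq_lead; move: y0; rewrite -mleadc_eq0 eq_lead mcoeffB -{2}leadt.
  by rewrite coeft subrr eqxx.
have [t' def_x] := IHx _ lt_lead (Vcl x t Vx).
by exists (t + t'); rewrite mulrDr -def_x addrC subrK.
Qed.

(** This is an instance of the normality of polynomial rings, for the fraction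
    [x / f]. It is enough to compare the leading monomials in
    [x * X^m = f * p], where [m] has the least exponent of the variable [X_i]
    among the monomials of [I], to which the monomials of [p] belong. *)
Lemma monomial_ideal_conductor I f x :
  monomial_ideal I -> I <> [set 0] -> f != 0 ->
  (forall u, I u -> exists2 p, I p & x * u = f * p) -> exists t, x = f * t.
Proof.
move=> monI I0 f0; have idI := monomial_ideal_ideal monI.
have [m0 Im0] := monomial_ideal_exX monI I0.
pose V := [set x : S | forall u, I u -> exists2 p, I p & x * u = f * p].
move: x; apply: (@mlead_descent V) => // [x t Vx u Iu|x Vx x0].
  have [p Ip xu] := Vx u Iu; exists (p - t * u).
    by apply: idealB => //; exact: idealM.
  by rewrite mulrBl xu mulrBr mulrA.
apply/mnm_lepP => i.
have [e [[m [Im def_e]] e_min]] :=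
  @ex_is_min [set k | exists m, I 'X_[m] /\ k = m i] (ex_intro _ _ (ex_intro _ m0 (conj Im0 erefl))).
have [p Ip xm] := Vx _ Im.
have Xm0 : 'X_[m] != 0 :> S by rewrite -msupp_eq0 msuppX.
have p0 : p != 0.
  by apply: contra_eq_neq xm => ->; rewrite mulr0 mulf_neq0.
have := congr1 (@mlead _ _) xm; rewrite !mleadM // mleadXm => /mnmP /(_ i).
rewrite !mnmDE.
have : (e <= mlead p i)%N.
  apply: e_min; exists (mlead p); split=> //.
  exact: monomial_ideal_msupp Ip (mlead_supp p0).
by rewrite def_e => le_mp eq_deg; rewrite -(leq_add2r (m i)) eq_deg leq_add2l.
Qed.

End Monomials.

(** * Regular sequences on an ideal *)

Section RegularSequences.
Variable R : idomainType.
Implicit Types (I : set R) (a b c t u : R).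

Lemma seq_mul_nil I u : ideal I -> seq_mul [::] I u <-> u = 0.
Proof.
move=> idI; split=> [[g _ ->]|->]; first by rewrite big_ord0.
by exists (fun=> 0) => [k|]; [exact: ideal0 | rewrite big_ord0].
Qed.

Lemma seq_mul_1 I a u : seq_mul [:: a] I u <-> exists2 p, I p & u = a * p.
Proof.
split=> [[g Ig ->]|[p Ip ->]]; first by exists (g 0%N); rewrite ?big_ord1.
by exists (fun=> p); rewrite ?big_ord1.
Qed.

Lemma seq_mul_2 I a b u :
  seq_mul [:: a; b] I u <-> exists p q, [/\ I p, I q & u = a * p + b * q].
Proof.
split=> [[g Ig ->]|[p [q [Ip Iq ->]]]].
  by exists (g 0%N), (g 1%N); rewrite big_ord_recl big_ord1.
exists (fun k => if k is 0 then p else q) => [[]//|].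
by rewrite big_ord_recl big_ord1.
Qed.

Lemma regular_head_neq0 I a fs :
  ideal I -> I <> [set 0] -> regular_seq I (a :: fs) -> a != 0.
Proof.
move=> idI I0 [reg _]; apply/eqP => a0; apply: I0; apply/seteqP; split.
- move=> u Iu; apply/(seq_mul_nil _ idI).
  have := reg 0%N isT u Iu; rewrite take0 /= a0 mul0r; apply.
  exact/seq_mul_nil.
- by move=> _ ->; exact: ideal0.
Qed.

(** If [a * t] lies in [I], then [b * (a * t)] lies in [a * I] as soon as
    [b * t] lies in [I]; regularity of [b] modulo [a * I] then gives
    [a * t \in a * I]. So two elements regular on [I] generate an ideal
    that kills no nonzero class modulo [I]. *)
Lemma regular2_colon I a b fs t :
  ideal I -> I <> [set 0] -> regular_seq I [:: a, b & fs] ->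
  I (a * t) -> I (b * t) -> I t.
Proof.
move=> idI I0 reg Iat Ibt; have a0 := regular_head_neq0 idI I0 reg.
case: reg => /(_ 1%N isT (a * t) Iat) /= reg _.
have /seq_mul_1[p Ip /(mulfI a0) -> //] : seq_mul [:: a] I (a * t).
by apply: reg; apply/seq_mul_1; exists (b * t) => //; rewrite mulrCA.
Qed.

End RegularSequences.

(** * Depth of a monomial ideal *)

Section Depth.
Variables (K : fieldType) (n : nat).
Local Notation S := {mpoly K[n]}.
Local Notation mm := (graded_maximal K n).
Implicit Types (I : set S) (f g u : S) (fs : seq S).

(** Nakayama's lemma: a monomial of least degree in [I] is not in [fs * I]. *)
Lemma seq_mul_proper I fs :
  monomial_ideal I -> I <> [set 0] -> (forall f, f \in fs -> mm f) ->
  seq_mul fs I <> I.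
Proof.
move=> monI I0 mfs eqI; have [m0 Im0] := monomial_ideal_exX monI I0.
have [d [[m [Im def_d]] d_min]] :=
  @ex_is_min [set d | exists m, I 'X_[m] /\ d = mdeg m]
    (ex_intro _ _ (ex_intro _ m0 (conj Im0 erefl))).
pose L := [set f : S | forall m, m \in msupp f -> (d < mdeg m)%N].
have idL : ideal L.
  by apply: (@msupp_ideal _ _ (fun m => d < mdeg m)%N) => k k'; rewrite mdegD; lia.
have: L 'X_[m].
  move: Im; rewrite -eqI => -[g Ig ->]; apply: ideal_big => // k _ m1.
  apply: graded_maximal_mdeg; first by apply: mfs; exact: mem_nth.
  move=> m2 /(monomial_ideal_msupp monI (Ig k)) Im2.
  by apply: d_min; exists m2.
by move=> /(_ m); rewrite msuppX mem_head def_d ltnn => /(_ isT).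
Qed.

Lemma depthI I d :
  (exists fs, [/\ size fs = d, forall f, f \in fs -> mm f & regular_seq I fs]) ->
  (forall fs, (forall f, f \in fs -> mm f) -> regular_seq I fs ->
     (size fs <= d)%N) ->
  depth I d.
Proof. by move=> ex_fs le_d; split=> // l [fs [<- mfs reg]]; exact: le_d. Qed.

(** By [regular2_colon], the first two elements of a longer regular sequence
    could not both multiply [u] into [I]. *)
Lemma depth_socle I u (i : 'I_n) :
  monomial_ideal I -> I <> [set 0] -> ~ I u -> (forall f, mm f -> I (f * u)) ->
  depth I 1.
Proof.
move=> monI I0 Iu mu; have idI := monomial_ideal_ideal monI; apply: depthI.
  exists [:: 'X_i]; split=> // [f|]; first by rewrite inE => /eqP->; exact: graded_maximalX.
  split=> [[|//] _ v Iv|]; last first.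
    by apply: seq_mul_proper => // f; rewrite inE => /eqP->; exact: graded_maximalX.
  move=> /(seq_mul_nil _ idI) /eqP; rewrite mulf_eq0 /= -msupp_eq0 msuppX /= => /eqP->.
  exact/seq_mul_nil.
case=> [|a [|b fs]] // mfs reg; case: Iu.
apply: (regular2_colon idI I0 reg); apply: mu; apply: mfs.
  by rewrite mem_head.
by rewrite !inE eqxx orbT.
Qed.

(** The function [phi] stands for a homomorphism from the maximal ideal to
    [S / I] that is not the multiplication by a class of [S / I], that is, for
    a nonzero element of the first Ext group of the residue field with values
    in [S / I]. Given [a], [b], [c] regular on [I], regularity of [c] puts
    [b * phi a - a * phi b] in [(a, b) * I]; correcting [phi a] and [phi b]
    by elements of [I] makes them proportional to [a] and [b], and the factor
    of proportionality [t] represents [phi]. *)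
Lemma regular_size_le2 I (phi : S -> S) fs :
  monomial_ideal I -> I <> [set 0] ->
  (forall f g, mm f -> mm g -> I (g * phi f - f * phi g)) ->
  (forall t, (forall f, mm f -> I (phi f - f * t)) -> False) ->
  (forall f, f \in fs -> mm f) -> regular_seq I fs -> (size fs <= 2)%N.
Proof.
move=> monI I0 phiC phiN; have idI := monomial_ideal_ideal monI.
case: fs => [|a [|b [|c fs]]] // mfs reg.
have a0 := regular_head_neq0 idI I0 reg.
have ma : mm a by apply: mfs; rewrite mem_head.
have mb : mm b by apply: mfs; rewrite !inE eqxx orbT.
have mc : mm c by apply: mfs; rewrite !inE eqxx !orbT.
have [/(_ 2%N isT (b * phi a - a * phi b) (phiC _ _ ma mb)) /= reg_c _] := reg.
have /seq_mul_2[p [q [Ip Iq def_pq]]] :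
    seq_mul [:: a; b] I (b * phi a - a * phi b).
  apply: reg_c; apply/seq_mul_2.
  exists (b * phi c - c * phi b), (c * phi a - a * phi c).
  by split; [exact: phiC | exact: phiC | ring].
have eq_ab : b * (phi a - q) = a * (phi b + p).
  transitivity ((b * phi a - a * phi b) + (a * phi b - b * q)); first by ring.
  by rewrite def_pq; ring.
have [t def_t] : exists t, phi a - q = a * t.
  apply: (monomial_ideal_conductor monI I0 a0) => u Iu.
  have Ixu : I ((phi a - q) * u) by exact: idealM.
  have [/(_ 1%N isT _ Ixu) /= reg_b _] := reg.
  apply/seq_mul_1/reg_b/seq_mul_1.
  by exists ((phi b + p) * u); [exact: idealM | rewrite !mulrA eq_ab].
have def_t' : phi b + p = b * t.
  by apply: (mulfI a0); rewrite -eq_ab def_t mulrCA.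
apply: False_ind; apply: (phiN t) => e me; apply: (regular2_colon idI I0 reg).
- have -> : a * (phi e - e * t) = a * phi e - e * (a * t) by ring.
  rewrite -def_t; have -> : a * phi e - e * (phi a - q) = (a * phi e - e * phi a) + e * q by ring.
  by apply: idealD => //; [exact: phiC | exact: idealM].
- have -> : b * (phi e - e * t) = b * phi e - e * (b * t) by ring.
  rewrite -def_t'; have -> : b * phi e - e * (phi b + p) = (b * phi e - e * phi b) - e * p by ring.
  by apply: idealB => //; [exact: phiC | exact: idealM].
Qed.

(** Modulo the variables other than [X_i], the sum of the variables is [X_i]. *)
Lemma radical_sumX (Q : set S) :
  monomial_ideal Q -> primary_ideal Q -> radical Q (\sum_i 'X_i) ->
  forall i, radical Q 'X_i.
Proof.
move=> monQ prQ radf i; apply: contrapT => radi; pose A := [set~ i]%SET.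
have QA : Q `<=` var_ideal A.
  by apply: primary_monomial_sub_var => // j Qj; rewrite !inE; apply/eqP => ji; rewrite ji in Qj.
have := radical_sub_prime (var_ideal_prime K A) QA radf.
rewrite (bigD1 i) //= => Af.
suff: var_ideal A ('X_i : S) by move=> /var_idealX; rewrite !inE eqxx.
rewrite -[X in var_ideal A X](addrK (\sum_(j < n | j != i) 'X_j)).
apply: idealB => //; first exact: var_ideal_ideal.
apply: ideal_big; first exact: var_ideal_ideal.
by move=> j ji; apply/var_idealX; rewrite !inE.
Qed.

(** When the maximal ideal is not associated to [S / I], the sum of the
    variables is regular modulo [I]; it starts a regular sequence on [I], which
    is continued by any variable other than its leading monomial. *)
Lemma ex_regular2 s (Q : 'I_s -> set S) I (j0 : 'I_s) :
  monomial_ideal I -> I <> [set 0] -> I = \bigcap_j Q j ->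
  (forall j, monomial_ideal (Q j) /\ primary_ideal (Q j)) ->
  (forall j, exists i, ~ radical (Q j) 'X_i) ->
  exists fs, [/\ size fs = 2%N, forall f, f \in fs -> mm f & regular_seq I fs].
Proof.
move=> monI I0 defI decQ radQ; have idI := monomial_ideal_ideal monI.
pose f : S := \sum_i 'X_i.
have mf : mm f.
  apply: ideal_big => [|i _]; first exact: graded_maximal_ideal.
  exact: graded_maximalX.
have Qf j : ~ radical (Q j) f.
  by have [monQ prQ] := decQ j; case: (radQ j) => i Qi /(radical_sumX monQ prQ) /(_ i) /Qi.
have f0 : f != 0.
  apply: contra_notN (Qf j0) => /eqP->; apply: ideal0; apply: radical_ideal.
  by have [/monomial_ideal_ideal] := decQ j0.
have regf u : I (f * u) -> I u.
  rewrite defI => If j _; have [_ [_ _ prQ]] := decQ j.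
  by case: (prQ u f) => // [|/Qf //]; rewrite mulrC; exact: If.
have [i0 leadf] : exists i, mlead f = U_(i)%MM.
  have := mlead_supp f0; rewrite mcoeff_msupp raddf_sum /= => nz.
  apply: contrapT => noi; move: nz; rewrite big1 ?eqxx // => i _.
  by rewrite mcoeffX; case: eqP => // eq_i; case: noi; exists i.
have [k ki0] : exists k : 'I_n, k != i0.
  have [m Im] := monomial_ideal_exX monI I0.
  have [_ prQ] := decQ j0; have [i Qi] := radQ j0.
  have Qm : radical (Q j0) 'X_[m] by apply: sub_radical; move: Im; rewrite defI; exact.
  have [i' _ Qi'] := prime_ideal_mpolyX (primary_radical_prime prQ) Qm.
  have [ii0|] := eqVneq i i0; last by exists i.
  by exists i'; apply/eqP => i'i0; apply: Qi; rewrite ii0 -i'i0.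
have mfs g : g \in [:: f; 'X_k] -> mm g.
  by rewrite !inE => /orP[] /eqP->; last exact: graded_maximalX.
exists [:: f; 'X_k]; split=> //; split; last exact: seq_mul_proper.
case=> [|[|//]] _ u Iu /=.
  move=> /(seq_mul_nil _ idI) /eqP; rewrite mulf_eq0 (negPf f0) => /eqP->.
  exact/seq_mul_nil.
move=> /seq_mul_1[v _ eq_uv].
have [t def_u] : exists t, u = f * t.
  pose V := [set x : S | exists v, 'X_k * x = f * v].
  apply: (@mlead_descent _ _ V f) => //; last by exists v.
  - by move=> x t [w xw]; exists (w - 'X_k * t); rewrite mulrBr xw; ring.
  - move=> x [w xw] x0; rewrite leadf lep1mP -lt0n.
    have Xk0 : 'X_k != 0 :> S by rewrite -msupp_eq0 msuppX.
    have w0 : w != 0 by apply: contra_eq_neq xw => ->; rewrite mulr0 mulf_neq0.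
    have := congr1 (@mlead _ _) xw; rewrite !mleadM // mleadXm leadf => /mnmP /(_ i0).
    by rewrite !mnmDE !mnm1E (negPf ki0) eqxx add0n add1n => ->.
by apply/seq_mul_1; exists t => //; apply: regf; rewrite -def_u.
Qed.

End Depth.

(** * The dimension of a polynomial ring *)

Section Dimension.
Variables (K : fieldType) (n : nat).
Local Notation S := {mpoly K[n]}.

Definition mdeg_le d (f : S) := forall m, m \in msupp f -> (mdeg m <= d)%N.

Lemma mdeg_leM d e f g : mdeg_le d f -> mdeg_le e g -> mdeg_le (d + e) (f * g).
Proof.
move=> fd ge m /msuppM_le /allpairsP[[m1 m2] /= [/fd m1d /ge m2e ->]].
by rewrite mdegD leq_add.
Qed.

Lemma mdeg_le_prod l N D (f : 'I_l -> S) (a : {ffun 'I_l -> 'I_N}) :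
  (forall i, mdeg_le D (f i)) -> mdeg_le (l * (N * D)) (\prod_i f i ^+ a i).
Proof.
move=> fD.
have pow i k : mdeg_le (k * D) (f i ^+ k).
  elim: k => [|k IHk]; last by rewrite exprS mulSn; exact: mdeg_leM.
  by rewrite expr0 => m; rewrite -mpolyC1 msupp1 inE => /eqP->; rewrite mdeg0.
have prod : mdeg_le (\sum_(i < l) a i * D) (\prod_i f i ^+ a i).
  apply: (big_ind2 (fun d u => mdeg_le d u)) => //; last by move=> *; exact: mdeg_leM.
  by move=> m; rewrite -mpolyC1 msupp1 inE => /eqP->; rewrite mdeg0.
move=> m /prod /leq_trans; apply.
rewrite -[X in (_ <= X * _)%N]card_ord -sum_nat_const.
by apply: leq_sum => i _; rewrite leq_mul2r ltnW ?orbT.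
Qed.

(** The number of products of powers with exponents below [N] grows faster with
    [N] than the number of monomials that can occur in them. *)
Lemma algebraic_dependence l (f : 'I_l -> S) :
  (n < l)%N ->
  exists N (v : {ffun 'I_l -> 'I_N} -> K),
    (exists a, v a != 0) /\ \sum_a v a *: \prod_i f i ^+ a i = 0.
Proof.
move=> lt_nl; pose D := (\max_(i < l) msize (f i))%N.
have fD i : mdeg_le D (f i).
  move=> m /msize_mdeg_lt /ltnW /leq_trans; apply.
  exact: (leq_bigmax (F := fun i => msize (f i))).
pose N := ((l * D).+1 ^ n).+1; pose E := (l * (N * D))%N.
pose rows := {ffun 'I_l -> 'I_N}; pose cols := {ffun 'I_n -> 'I_E.+1}.
pose mon (b : cols) := [multinom (b i : nat) | i < n].
pose M := \matrix_(r < #|{: rows}|, c < #|{: cols}|)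
  (\prod_i f i ^+ (enum_val r : rows) i)@_(mon (enum_val c)).
have lt_cr : (#|{: cols}| < #|{: rows}|)%N.
  rewrite !card_ffun !card_ord.
  have leE : (E.+1 <= N * (l * D).+1)%N by rewrite /E; nia.
  have leEn : (E.+1 ^ n <= (N * (l * D).+1) ^ n)%N.
    by case: (posnP n) => [->|n0]; rewrite ?expn0 // leq_exp2r.
  apply: leq_ltn_trans leEn _.
  rewrite expnMn; apply: (@leq_trans (N ^ n * N)%N).
    by rewrite ltn_pmul2l ?expn_gt0 ?ltnS.
  by rewrite -expnSr leq_pexp2l.
have /matrix0Pn[i [j kij]] : kermx M != 0.
  rewrite -mxrank_eq0 mxrank_ker subn_eq0 -ltnNge.
  exact: leq_ltn_trans (rank_leq_col M) lt_cr.
exists N, (fun a => kermx M i (enum_rank a)); split.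
  by exists (enum_val j); rewrite enum_valK.
apply/mpolyP => m; rewrite mcoeff0 raddf_sum /=.
have [/forallP mE|/forallPn[k mk]] := boolP [forall k, (m k < E.+1)%N]; last first.
  rewrite big1 // => a _; rewrite mcoeffZ [X in _ * X](_ : _ = 0) ?mulr0 //.
  apply/eqP; rewrite mcoeff_eq0; apply/negP => /(mdeg_le_prod fD) ma.
  move: mk; rewrite ltnS; apply/negP; rewrite negbK; apply: leq_trans ma.
  by rewrite mdegE (bigD1 k) //= leq_addr.
pose b : cols := [ffun k => Ordinal (mE k)].
have def_m : m = mon b by apply/mnmP => k; rewrite mnmE ffunE.
have := congr1 (fun A : 'M_(_, _) => A i (enum_rank b)) (mulmx_ker M).
rewrite !mxE => {}E0; rewrite -[RHS]E0 [RHS](reindex enum_rank) /=; last first.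
  by apply: onW_bij; exact: enum_rank_bij.
by apply: eq_bigr => a _; rewrite mcoeffZ !mxE !enum_rankK -def_m.
Qed.

(** Choosing an element of each ideal of a chain of primes outside the previous
    one gives algebraically independent elements. Indeed, in a relation among
    them one may isolate the terms with the least exponent in the first element,
    divide by that power, and then pass to the next prime, which contains the
    remaining terms; after the last prime a nonzero constant is left. *)
Lemma prime_chain_independent l (C : nat -> set S) (f : 'I_l -> S)
    N (v : {ffun 'I_l -> 'I_N} -> K) a :
  (forall i, (i <= l)%N -> prime_ideal (C i)) ->
  (forall i : 'I_l, C i.+1 (f i) /\ ~ C i (f i)) ->
  (forall i, (i < l)%N -> C i `<=` C i.+1) ->
  v a != 0 -> \sum_a v a *: \prod_i f i ^+ a i <> 0.
Proof.
move=> prC Cf CS va0 rel0.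
pose agree k (a b : {ffun 'I_l -> 'I_N}) := [forall i : 'I_l, (i < k)%N ==> (a i == b i)].
have agreeP k (b c : {ffun 'I_l -> 'I_N}) :
    reflect (forall i : 'I_l, (i < k)%N -> b i = c i) (agree k b c).
  by apply: (iffP forallP) => bc i; [move/implyP: (bc i) => bi /bi/eqP | apply/implyP => /bc->].
pose tail k (b : {ffun 'I_l -> 'I_N}) : S := \prod_(i < l | (k <= i)%N) f i ^+ b i.
suff step k : (k <= l)%N -> exists2 b, v b != 0 &
    C k (\sum_(c | agree k b c) v c *: tail k c).
  have [b vb0] := step l (leqnn l).
  have -> : \sum_(c | agree l b c) v c *: tail l c = (v b)%:MP.
    rewrite (bigD1 b) /=; last by apply/agreeP.
    rewrite big1 => [|c /andP[/agreeP bc /eqP[]]]; last by apply/ffunP => i; rewrite bc.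
    by rewrite addr0 /tail big1 -?alg_mpolyC // => i; rewrite leqNgt ltn_ord.
  have /prime_idealP[idC C1 _] := prC l (leqnn l).
  move=> Cv; apply: C1; rewrite -mpolyC1 -(mulVf vb0) mpolyCM.
  exact: idealM.
elim: k => [|k IHk] ltkl.
  exists a => //; rewrite [X in C 0%N X](_ : _ = 0).
    by have /prime_idealP[/ideal0] := prC 0%N (leq0n l).
  rewrite -[RHS]rel0; apply: eq_big => [c|c _]; first exact/agreeP.
  by congr (_ *: _); apply: eq_bigl.
have [b vb0 Cb] := IHk (ltnW ltkl); pose o := Ordinal ltkl.
have [idC C1 Cpr] := (prime_idealP _).1 (prC k (ltnW ltkl)).
have /prime_idealP[idC' _ _] := prC k.+1 ltkl.
have [Cfo Cfo'] := Cf o.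
have [|c /andP[/agreeP bc vc0] c_min] :=
    @arg_minnP _ b (fun c => agree k b c && (v c != 0)) (fun c => c o).
  by rewrite vb0 andbT; apply/agreeP.
exists c => //.
pose T d := v d *: (f o ^+ (d o - c o) * tail k.+1 d).
have tailS d : tail k d = f o ^+ d o * tail k.+1 d.
  rewrite /tail (bigD1 o) //=; congr (_ * _); apply: eq_bigl => i.
  by rewrite -val_eqE /= eq_sym ltn_neqAle andbC.
have CT : C k (\sum_(d | agree k b d) T d).
  have: C k (f o ^+ c o * \sum_(d | agree k b d) T d).
    rewrite mulr_sumr; move: Cb; congr (C k _); apply: eq_bigr => d bd.
    rewrite /T -scalerAr mulrA -exprD tailS.
    have [->|vd0] := eqVneq (v d) 0; first by rewrite !scale0r.
    by rewrite subnKC // c_min // bd.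
  by case/Cpr => // /(prime_ideal_exp (prC k (ltnW ltkl))) /Cfo'.
have {}CT := CS k ltkl _ CT; rewrite (bigID (fun d : {ffun 'I_l -> 'I_N} => d o == c o)) /= in CT.
have CT2 : C k.+1 (\sum_(d | agree k b d && (d o != c o)) T d).
  apply: ideal_big => // d /andP[bd dc]; rewrite /T.
  have [->|vd0] := eqVneq (v d) 0; first by rewrite scale0r; exact: ideal0.
  apply: ideal_mpolyZ => //; apply: ideal_mulr => //.
  have : (0 < d o - c o)%N.
    by rewrite subn_gt0 ltn_neqAle eq_sym dc c_min // bd.
  by case: (_ - _)%N => // p _; rewrite exprS; exact: ideal_mulr.
have := idealB idC' CT CT2; rewrite addrK; congr (C k.+1 _).
apply: eq_big => [d|d /andP[_ /eqP dc]]; last by rewrite /T dc subnn expr0 mul1r.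
apply/andP/agreeP => [[/agreeP bd /eqP dc] i|cd].
  rewrite ltnS leq_eqVlt => /orP[/eqP ik|ik]; last by rewrite -bc // bd.
  by have -> : i = o by apply: val_inj.
split; last by rewrite (cd o) //= ltnSn.
by apply/agreeP => i ik; rewrite bc // cd // ltnW.
Qed.

Lemma prime_chain_length l (C : nat -> set S) :
  (forall i, (i <= l)%N -> prime_ideal (C i)) ->
  (forall i, (i < l)%N -> C i `<` C i.+1) -> (l <= n)%N.
Proof.
move=> prC CS; rewrite leqNgt; apply/negP => lt_nl.
have /choice[f Cf] (i : 'I_l) : exists f, C i.+1 f /\ ~ C i f.
  have [_ /nonsubset[f [Cf Cf']]] := CS i (ltn_ord i).
  by exists f.
have [N [v [[a va0] rel0]]] := algebraic_dependence f lt_nl.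
by apply: (prime_chain_independent prC Cf _ va0 rel0) => i /CS[].
Qed.

End Dimension.

(** * The height of a sum of primary monomial ideals *)

Section Height.
Variables (K : fieldType) (n : nat).
Local Notation S := {mpoly K[n]}.
Implicit Types (A B : {set 'I_n}) (P : set S).

Definition flag A B (k : nat) : {set 'I_n} := (A :|: [set i in take k (enum B)])%SET.

Lemma flag_proper A B k :
  (B \subset ~: A)%SET -> (k < #|B|)%N ->
  (flag A B k \proper flag A B k.+1)%SET.
Proof.
move=> /fintype.subsetP BA; rewrite cardE => ltk.
have [i0 _] : exists i0 : 'I_n, true by case: (enum B) ltk => // i0 *; exists i0.
have takeS : take k.+1 (enum B) = rcons (take k (enum B)) (nth i0 (enum B) k).
  exact: take_nth.
apply/properP; split.
  apply/fintype.subsetP => i; rewrite !inE takeS mem_rcons inE => /orP[->//|->].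
  by rewrite !orbT.
exists (nth i0 (enum B) k); first by rewrite !inE takeS mem_rcons mem_head orbT.
have: uniq (take k.+1 (enum B)) by rewrite take_uniq ?enum_uniq.
rewrite takeS rcons_uniq => /andP[nk _]; rewrite !inE (negPf nk) orbF.
rewrite -finset.in_setC BA // -mem_enum; exact: mem_nth.
Qed.

Lemma flag0 A B : flag A B 0 = A.
Proof. by apply/setP => i; rewrite !inE take0 orbF. Qed.

Lemma flag_card A B : flag A B #|B| = (A :|: B)%SET.
Proof. by apply/setP => i; rewrite !inE cardE take_size mem_enum. Qed.

(** Adding the variables of [A] one by one gives a chain of length [#|A|]. *)
Lemma prime_height_ge P A l :
  prime_ideal P -> var_ideal A `<=` P -> prime_height P l -> (#|A| <= l)%N.
Proof.
move=> prP AP [_ Pmax]; apply: Pmax.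
exists (fun k => if (k < #|A|)%N then var_ideal (flag finset.set0 A k) else P); split.
- by move=> k _; case: ifP => // _; exact: var_ideal_prime.
- move=> k ltkA; rewrite ltkA.
  have prop : var_ideal (flag finset.set0 A k) `<` (var_ideal (flag finset.set0 A k.+1) : set S).
    by apply: var_ideal_proper; apply: flag_proper; rewrite ?finset.setC0 ?finset.subsetT.
  case: ltnP => [//|leAk].
  have eqk : k.+1 = #|A| by apply/eqP; rewrite eqn_leq ltkA leAk.
  move: prop; rewrite eqk flag_card finset.set0U => -[FA AF].
  by split; [exact: classical_sets.subset_trans AP | move=> PF; apply: AF; exact: classical_sets.subset_trans PF].
- by rewrite ltnn.
Qed.

(** A chain of primes ending at [var_ideal A] can be prolonged up to the maximal
    ideal by adding the remaining [n - #|A|] variables one by one, so the bound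
    [n] on its length leaves at most [#|A|] steps below [var_ideal A]. *)
Lemma var_ideal_height A : prime_height (var_ideal A : set S) #|A|.
Proof.
split; last first.
  move=> l [C [prC CS Cl]]; pose B := (~: A)%SET.
  suff: (l + #|B| <= n)%N.
    have cardAB : (#|A| + #|B|)%N = n by rewrite cardsC card_ord.
  by move=> le_n; rewrite -(leq_add2r #|B|) cardAB.
  pose C' k := if (k < l)%N then C k else var_ideal (flag A B (k - l)) : set S.
  apply: (@prime_chain_length K n _ C') => k; rewrite /C'.
    by case: ifP => [/ltnW/prC //|_ _]; exact: var_ideal_prime.
  move=> ltk; case: (ltngtP k.+1 l) => [ltkl|ltlk|eqkl].
  - by apply: CS; exact: ltnW.
  - have lelk : (l <= k)%N by [].
    rewrite subSn //.
    apply: var_ideal_proper; apply: flag_proper; first exact: fintype.subxx.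
    by rewrite -(ltn_add2r l) subnK // addnC.
  - by rewrite eqkl subnn flag0 -Cl -eqkl; apply: CS; rewrite eqkl.
exists (fun k => var_ideal (flag finset.set0 A k)); split.
- by move=> k _; exact: var_ideal_prime.
- move=> k ltk; apply: var_ideal_proper; apply: flag_proper => //.
  by rewrite finset.setC0 finset.subsetT.
- by rewrite flag_card finset.set0U.
Qed.

Variables (s : nat) (Q : 'I_s -> set S).
Hypothesis decQ : forall j, monomial_ideal (Q j) /\ primary_ideal (Q j).

Definition radical_vars : {set 'I_n} :=
  [set i | `[< radical (ideal_sum Q [set: 'I_s]%SET) 'X_i >]]%SET.

Lemma radical_varsP i :
  i \in radical_vars <-> radical (ideal_sum Q [set: 'I_s]%SET) 'X_i.
Proof. by rewrite inE; split=> /asboolP. Qed.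

Lemma component_ideal j : ideal (Q j).
Proof. by have [/monomial_ideal_ideal] := decQ j. Qed.

Lemma component_sub_sum j : Q j `<=` ideal_sum Q [set: 'I_s]%SET.
Proof. by apply: sub_ideal_sum; [exact: component_ideal | rewrite inE]. Qed.

Lemma component_sub_var j : Q j `<=` var_ideal radical_vars.
Proof.
have [monQ prQ] := decQ j; apply: primary_monomial_sub_var => // i Qi.
apply/radical_varsP; apply: radical_sub Qi; exact: component_sub_sum.
Qed.

Lemma sum_sub_var : ideal_sum Q [set: 'I_s]%SET `<=` var_ideal radical_vars.
Proof.
apply: ideal_sum_sub; first exact: var_ideal_ideal.
by move=> j _; exact: component_sub_var.
Qed.

Lemma radical_sum :
  radical (ideal_sum Q [set: 'I_s]%SET) = var_ideal radical_vars.
Proof.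
apply/seteqP; split.
  exact: radical_sub_prime (var_ideal_prime _ _) sum_sub_var.
apply: var_ideal_sub => [|i /radical_varsP //].
by apply: radical_ideal; apply: ideal_sum_ideal; exact: component_ideal.
Qed.

(** A prime contains the sum of the components if and only if it contains its
    radical, which is itself prime; so the height is that of the radical. *)
Lemma height_sum b : height (ideal_sum Q [set: 'I_s]%SET) b -> b = #|radical_vars|.
Proof.
case=> [[P [prP JP heiP]] b_min]; apply/eqP; rewrite eqn_leq; apply/andP; split.
  apply: b_min; exists (var_ideal radical_vars); split.
  - exact: var_ideal_prime.
  - exact: sum_sub_var.
  - exact: var_ideal_height.
apply: (prime_height_ge prP _ heiP); rewrite -radical_sum.
exact: (radical_sub_prime prP JP).
Qed.

End Height.

(** * Depth in the three cases *)

Section Cases.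
Variables (K : fieldType) (n s : nat).
Local Notation S := {mpoly K[n]}.
Local Notation mm := (graded_maximal K n).
Variables (I : set S) (Q : 'I_s -> set S).
Hypothesis (monI : monomial_ideal I) (I0 : I <> [set 0]).
Hypothesis decQ : forall j, monomial_ideal (Q j) /\ primary_ideal (Q j).
Hypothesis defI : I = \bigcap_j Q j.

Let idI : ideal I := monomial_ideal_ideal monI.
Let idQ : forall j, ideal (Q j) := component_ideal decQ.

Lemma primary_cancel (P : set S) u v :
  primary_ideal P -> ~ radical P u -> P (u * v) -> P v.
Proof. by move=> [_ _ prP] Pu; rewrite mulrC => /prP[]. Qed.

Lemma sub_component j : I `<=` Q j.
Proof. by rewrite defI => u; exact. Qed.

(** The class [u] is obtained from an element of the other components by
    multiplying it with a maximal monomial that keeps it outside [Q j]. *)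
Lemma depth_embedded j :
  \bigcap_(k in [set k | k <> j]) Q k <> I ->
  (forall i, radical (Q j) 'X_i) -> depth I 1.
Proof.
move=> irr radQ; have [m0 Im0] := monomial_ideal_exX monI I0.
have [v Jv Qv] : exists2 v, (\bigcap_(k in [set k | k <> j]) Q k) v & ~ Q j v.
  apply: contrapT => nov; apply: irr; apply/seteqP; split=> u Ju; last first.
    by move=> k _; exact: sub_component.
  rewrite defI => k _; have [->|/eqP kj] := eqVneq k j; last exact: Ju.
  by apply: contrapT => Qu; apply: nov; exists u.
have [m Qm mQ] : exists2 m, ~ Q j ('X_[m] * v) & forall i, Q j ('X_[U_(i) + m] * v).
  apply: (@ex_socle_monomial _ (fun m => Q j ('X_[m] * v))) => [m m' Qm|i|].
  - by rewrite mpolyXD -mulrA; exact: idealM.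
  - by have [k Qk] := radQ i; exists k; rewrite -mpolyXn; exact: ideal_mulr.
  - by rewrite mpolyX0 mul1r.
have [i _ _] := prime_ideal_mpolyX (primary_radical_prime (decQ j).2)
  (sub_radical (sub_component j Im0)).
apply: (@depth_socle _ _ I ('X_[m] * v) i) => // [/sub_component/Qm//|f mf].
rewrite defI => k _; have [->|/eqP kj] := eqVneq k j; last first.
  by apply: idealM => //; apply: idealM => //; exact: Jv.
suff: mm `<=` [set f | Q j (f * ('X_[m] * v))] by move=> /(_ f mf).
apply: graded_maximal_sub; first exact: colon_ideal.
by move=> i' /=; rewrite mulrA -mpolyXD.
Qed.

Lemma depth_eq2 (j0 : 'I_s) (phi : S -> S) :
  (forall j, exists i, ~ radical (Q j) 'X_i) ->
  (forall f g, mm f -> mm g -> I (g * phi f - f * phi g)) ->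
  (forall t, (forall f, mm f -> I (phi f - f * t)) -> False) ->
  depth I 2.
Proof.
move=> radQ phiC phiN; apply: depthI.
  exact: (ex_regular2 j0 monI I0 defI decQ radQ).
by move=> fs; exact: (regular_size_le2 monI I0 phiC phiN).
Qed.

Lemma ex_socle (L : set S) :
  ideal L -> ~ L 1 -> (forall i, radical L 'X_i) ->
  exists2 w, ~ L w & forall f, mm f -> L (f * w).
Proof.
move=> idL L1 radL.
have [m Lm mL] : exists2 m, ~ L 'X_[m] & forall i, L 'X_[U_(i) + m].
  apply: (@ex_socle_monomial _ (fun m => L 'X_[m])) => [m m' Lm|i|].
  - by rewrite mpolyXD; exact: idealM.
  - by have [k Lk] := radL i; exists k; rewrite -mpolyXn.
  - by rewrite mpolyX0.
exists 'X_[m] => //; apply: graded_maximal_sub; first exact: colon_ideal.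
by move=> i /=; rewrite -mpolyXD.
Qed.

Lemma ideal_sum_mpolyX (A : {set 'I_s}) m :
  ideal_sum Q A 'X_[m] -> exists2 j, j \in A & Q j 'X_[m].
Proof.
case=> g Qg def_m; apply: contrapT => noj.
have : ('X_[m] : S)@_m != 0 by rewrite mcoeffX eqxx oner_neq0.
rewrite def_m raddf_sum /= big1 ?eqxx // => j jA; apply/eqP.
rewrite mcoeff_eq0; apply/negP => mg; apply: noj; exists j => //.
exact: monomial_ideal_msupp (decQ j).1 (Qg j jA) mg.
Qed.

(** None of the primes is the maximal ideal, but the one of [Q j0] and any other
    span it, so removing the closed point from the spectrum of [S / I] separates
    the component [Q j0] from the others. The function [phi] represents the class
    in the first local cohomology of [S / I] that comes from the socle of
    [S / (Q_j0 + J)], with [J] the intersection of the other components. *)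
Lemma depth_disconnected (j0 j1 : 'I_s) :
  j1 != j0 ->
  (forall j i, j != j0 -> radical (ideal_sum Q [set j0; j]%SET) 'X_i) ->
  (forall j, exists i, ~ radical (Q j) 'X_i) -> depth I 2.
Proof.
move=> j10 radQQ radQ.
pose J := \bigcap_(k in [set k | k <> j0]) Q k.
have idJ : ideal J by exact: ideal_bigcap.
have defIJ u : Q j0 u -> J u -> I u.
  move=> Qu Ju; rewrite defI => k _.
  by have [->//|/eqP kj] := eqVneq k j0; exact: Ju.
pose L := ideal_add (Q j0) J; have idL : ideal L by exact: ideal_addP.
have L1 : ~ L 1.
  move=> [p [q [Qp Jq def1]]]; apply: (@var_ideal1 K n (radical_vars Q)).
  rewrite def1; apply: idealD; first exact: var_ideal_ideal.
  - exact: (component_sub_var decQ Qp).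
  - by apply: (component_sub_var decQ (j := j1)); apply: Jq; apply/eqP.
have radL i : radical L 'X_i.
  have [Q0i|Q0i] := pselect (radical (Q j0) 'X_i).
    by apply: radical_sub Q0i => u; exact: ideal_addl.
  have /choice[e Qe] (j : 'I_s) : exists e, j != j0 -> Q j ('X_i ^+ e).
    have [->|jj0] := eqVneq j j0; first by exists 0%N.
    have [e] := radQQ j i jj0; rewrite mpolyXn => /ideal_sum_mpolyX[k].
    rewrite !inE -mpolyXn => /orP[] /eqP-> Qk; last by exists e.
    by case: Q0i; exists e.
  exists (\sum_j e j)%N; apply: ideal_addr => // k /eqP kj0.
  by rewrite (bigD1 k) //= exprD; apply: ideal_mulr => //; exact: Qe.
have [w Lw mw] := ex_socle idL L1 radL.
have /choice[phi phiP] e : exists p, mm e -> Q j0 p /\ J (e * w - p).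
  have [/mw[p [q [Qp Jq ->]]]|nme] := pselect (mm e); last by exists 0.
  by exists p; rewrite addrAC subrr add0r.
apply: (@depth_eq2 j0 phi) => // [f g mf mg|t phit].
  have [[Qf Jf] [Qg Jg]] := (phiP f mf, phiP g mg).
  apply: defIJ; first by apply: idealB => //; exact: idealM.
  have -> : g * phi f - f * phi g = f * (g * w - phi g) - g * (f * w - phi f) by ring.
  by apply: (idealB idJ); apply: (idealM _ idJ).
have Qt : Q j0 t.
  have [i Qi] := radQ j0; apply: primary_cancel (decQ j0).2 Qi _.
  have mi : mm 'X_i := graded_maximalX i; have [Qphi _] := phiP _ mi.
  have -> : 'X_i * t = phi 'X_i - (phi 'X_i - 'X_i * t) by ring.
  by apply: idealB => //; apply: sub_component; exact: phit.
have Jwt : J (w - t).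
  move=> k kj0; have [i Qi] := radQ k; apply: primary_cancel (decQ k).2 Qi _.
  have mi : mm 'X_i := graded_maximalX i; have [_ Jphi] := phiP _ mi.
  have -> : 'X_i * (w - t) = ('X_i * w - phi 'X_i) + (phi 'X_i - 'X_i * t) by ring.
  by apply: idealD => //; [exact: Jphi | apply: sub_component; exact: phit].
by apply: Lw; exists t, (w - t); split=> //; rewrite addrC subrK.
Qed.

(** When [S / I] is primary of dimension one, with parameter [y], the function
    [phi] represents the class in the first local cohomology of [S / I] that
    comes from the socle of [S / (I + (y))]. *)
Lemma depth_line (j0 : 'I_s) (y : 'I_n) :
  I = Q j0 -> ~ radical I 'X_y -> (forall i, i != y -> radical I 'X_i) ->
  (forall j, exists i, ~ radical (Q j) 'X_i) -> depth I 2.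
Proof.
move=> IQ Iy Ii radQ; have prI : primary_ideal I by rewrite IQ; exact: (decQ j0).2.
pose Y := [set f : S | exists t, f = 'X_y * t].
have idY : ideal Y by exact: principal_ideal.
pose L := ideal_add I Y; have idL : ideal L by exact: ideal_addP.
have L1 : ~ L 1.
  move=> [p [_ [Ip [t ->] def1]]]; apply: (@var_ideal1 K n [set: 'I_n]%SET).
  have idT := var_ideal_ideal K [set: 'I_n]%SET; rewrite def1; apply: idealD => //.
    by apply: primary_monomial_sub_var Ip => // i _; rewrite inE.
  by apply: ideal_mulr => //; apply/var_idealX; rewrite inE.
have radL i : radical L 'X_i.
  have [->|/Ii] := eqVneq i y.
    by apply: sub_radical; apply: ideal_addr => //; exists 1; rewrite mulr1.
  by apply: radical_sub => u; exact: ideal_addl.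
have [w Lw mw] := ex_socle idL L1 radL.
have /choice[phi phiP] e : exists p, mm e -> I (e * w - 'X_y * p).
  have [/mw[p [_ [Ip [t ->] ->]]]|nme] := pselect (mm e); last by exists 0.
  by exists t; rewrite addrK.
apply: (@depth_eq2 j0 phi) => // [f g mf mg|t phit].
  apply: primary_cancel prI Iy _.
  have -> : 'X_y * (g * phi f - f * phi g) =
      f * (g * w - 'X_y * phi g) - g * (f * w - 'X_y * phi f) by ring.
  by apply: idealB => //; apply: idealM => //; exact: phiP.
apply: Lw; exists (w - 'X_y * t), ('X_y * t); split; [|by exists t|by rewrite subrK].
have my : mm 'X_y := graded_maximalX y; apply: primary_cancel prI Iy _.
have -> : 'X_y * (w - 'X_y * t) =
    ('X_y * w - 'X_y * phi 'X_y) + 'X_y * (phi 'X_y - 'X_y * t) by ring.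
by apply: idealD; [| exact: phiP | apply: idealM => //; exact: phit].
Qed.

(** ** Sums of components with full radical *)

Lemma ideal_sum1 j : ideal_sum Q [set j]%SET = Q j.
Proof.
apply/seteqP; split; last by apply: sub_ideal_sum => //; rewrite inE.
by apply: ideal_sum_sub => // k; rewrite inE => /eqP->.
Qed.

Lemma sum_radical_full_neq0 (j0 : 'I_s) (A : {set 'I_s}) :
  sum_radical_full Q A -> (0 < #|A|)%N.
Proof.
rewrite card_gt0 => fullA; apply/eqP => A0.
have [m Im] := monomial_ideal_exX monI I0.
have: radical (ideal_sum Q A) 'X_[m].
  by rewrite fullA; apply: sub_radical; apply: component_sub_sum (sub_component j0 Im).
case=> k [g _]; rewrite A0 big_set0 mpolyXn => /eqP.
by rewrite -msupp_eq0 msuppX.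
Qed.

End Cases.

Theorem corollary1p5 (K : fieldType) (n : nat) (I : set {mpoly K[n]})
    (I_monomial : monomial_ideal I)
    (I_nonzero : I <> [set 0])
    (I_proper : I <> setT)
    (s : nat) (Q : 'I_s -> set {mpoly K[n]})
    (Q_decomposition : monomial_primary_decomposition I Q)
    (bigsize_eq1 : bigsize_of Q 1) :
  minimal_depth I Q.
Proof.
case: Q_decomposition => decQ injQ defI irrQ.
case: bigsize_eq1 => a' [b] [[[/andP[a'_gt0 le_a's] full] _] hei_b eq1].
have def_b := height_sum decQ hei_b; set A := radical_vars Q in def_b.
have le_bn : (b <= n)%N by rewrite def_b -[X in (_ <= X)%N]card_ord max_card.
have j0 : 'I_s by exact: Ordinal (leq_trans a'_gt0 le_a's).
have gt0 (B : {set 'I_s}) : sum_radical_full Q B -> (0 < #|B|)%N.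
  exact: (sum_radical_full_neq0 I_monomial I_nonzero decQ defI j0).
have full1 j : sum_radical_full Q [set j]%SET -> radical (Q j) = var_ideal A.
  by rewrite /sum_radical_full (ideal_sum1 decQ) (radical_sum decQ).
have [[a'1 b_n]|[a'2 b_n]] : (a' = 1 /\ n = b.+1)%N \/ (a' = 2 /\ n = b)%N by lia.
(* all the radicals agree, so there is a single component *)
- have fullj j : sum_radical_full Q [set j]%SET by apply: full; rewrite cards1.
  have allj j : j = j0.
    by apply: injQ; rewrite (full1 _ (fullj j)) (full1 _ (fullj j0)).
  have IQ : I = Q j0.
    by rewrite defI; apply/seteqP; split=> [u|u Qu j _]; [exact | rewrite (allj j)].
  have radI : radical I = var_ideal A by rewrite IQ; exact: full1.
  have /cards1P[y def_y] : #|(~: A)%SET| == 1%N.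
    have := cardsC A; rewrite card_ord -def_b => cardC.
    by apply/eqP/(@addnI b); rewrite cardC b_n addn1.
  have memA i : (i \in A) = (i != y).
    by rewrite -[LHS]negbK -finset.in_setC def_y inE.
  have Iy : ~ radical I 'X_y by rewrite radI => /var_idealX; rewrite memA eqxx.
  exists 2%N, 1; split=> //.
  + apply: (depth_line I_monomial I_nonzero decQ defI IQ Iy).
      by move=> i iy; rewrite radI; apply/var_idealX; rewrite memA.
    by move=> j; exists y; rewrite (allj j) -IQ.
  + exists 1%N, b; split=> //; last by lia.
    split; first by exists [set j0]%SET; rewrite ?cards1.
    by move=> _ [B <-] /gt0.
have A_T : A = [set: 'I_n]%SET.
  by apply/eqP; rewrite eqEcard finset.subsetT cardsT card_ord -def_b -b_n leqnn.
have radT j i : sum_radical_full Q [set j]%SET -> radical (Q j) 'X_i.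
  by move=> /full1->; apply/var_idealX; rewrite A_T inE.
have [[j radj]|noj] := pselect (exists j, forall i, radical (Q j) 'X_i).
(* the radical of [Q j] contains every variable, so [Q j] alone has the same
   radical as the whole sum *)
- exists 1%N, 0; split=> //.
    exact: (depth_embedded I_monomial I_nonzero decQ defI (irrQ j) radj).
  exists 1%N, b; split=> //; last by lia.
  split; last by move=> _ [B <-] /gt0.
  exists [set j]%SET; first by rewrite cards1.
  rewrite /sum_radical_full (ideal_sum1 decQ) (radical_sum decQ) -/A.
  apply/seteqP; split.
    apply: radical_sub_prime (var_ideal_prime _ _) _; exact: component_sub_var.
  by apply: var_ideal_sub => //; apply: radical_ideal; exact: component_ideal.
(* no single component suffices, since its radical would contain every
   variable, while any two components do *)
have radQ j : exists i, ~ radical (Q j) 'X_i.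
  by apply: contrapT => noi; apply: noj; exists j => i; apply: contrapT => Qi;
    apply: noi; exists i.
have [j1 j10] : exists j1, j1 != j0.
  have : (1 < #|[set: 'I_s]%SET|)%N by rewrite cardsT card_ord -a'2.
  rewrite (cardsD1 j0) inE add1n ltnS card_gt0 => /set0Pn[j1].
  by rewrite !inE andbT; exists j1.
have full2 j : j != j0 -> sum_radical_full Q [set j0; j]%SET.
  by move=> jj0; apply: full; rewrite cards2 eq_sym jj0 a'2.
exists 2%N, 1; split=> //.
  apply: (depth_disconnected I_monomial I_nonzero decQ defI j10) => // j i jj0.
  by rewrite (full2 _ jj0); apply/radical_varsP; rewrite -/A A_T inE.
exists 2%N, b; split=> //; last by lia.
split; first by exists [set j0; j1]%SET; [rewrite cards2 eq_sym j10 | exact: full2].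
move=> _ [B <-] fullB; have := gt0 B fullB.
rewrite leq_eqVlt => /orP[/eqP/esym/eqP/cards1P[j def_B]|//].
by case: (radQ j) => i []; apply: radT; rewrite -def_B.
Qed.
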